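(* Let $m,n\ge1$, $\gamma>0$, let $\bm{M}\in\mathbb{S}^{m\times m}_{++}$, $\bm{N}\in\mathbb{S}^{n\times n}_{++}$ be side information matrices and $\widehat{\mathcal{D}}$ a quasi-dimension estimator, and let $\mathcal{K},\mathcal{L},\mathcal{X}$ be as defined in the context. Assume that we have an algorithm for the OSDP problem $(\mathcal{K},\mathcal{L})$ with regret $\mathrm{Regret}_{\mathrm{OSDP}}(T,\mathcal{K},\mathcal{L},\bm{W}^* )$ with respect to any $\bm{W}^*\in\mathcal{K}$. Then there exists an algorithm for the binary matrix completion problem whose number of mistakes $M$ on a sequence $\mathcal{S}$ satisfies $$M\le\inf_{\bar{\bm{P}}\bar{\bm{Q}}^T\in\mathcal{X}}\left(\mathrm{Regret}_{\mathrm{OSDP}}(M,\mathcal{K},\mathcal{L},\bm{W}_{\bm{P},\bm{Q}})+\mathrm{hloss}(\mathcal{S},(\bm{P},\bm{Q}),\gamma)\right)\le\sup_{\bm{W}^*\in\mathcal{K}}\mathrm{Regret}_{\mathrm{OSDP}}(M,\mathcal{K},\mathcal{L},\bm{W}^* )+\mathrm{hloss}(\mathcal{S},\gamma),$$ where $\mathrm{Regret}_{\mathrm{OSDP}}(M,\mathcal{K},\mathcal{L},\cdot)$ is the regret of the given OSDP algorithm on the sequence of $M$ loss matrices from $\mathcal{L}$ that the matrix completion algorithm feeds to it.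
   Context: Notation: $[k]=\{1,\dots,k\}$; $\mathbb{S}^{k\times k}_{++}$ is the set of real symmetric strictly positive definite $k\times k$ matrices; $\bm{A}\bullet\bm{B}=\sum_{i,j}\bm{A}_{i,j}\bm{B}_{i,j}$; $\bm{e}_k$ is the $k$-th standard basis vector of $\mathbb{R}^N$; $N=m+n$; $\bm{A}_i$ is the $i$-th row of $\bm{A}$; $\mathcal{R}_{\bm{M}}=\max_i(\bm{M}^+)_{ii}$ with $\bm{M}^+$ the pseudo-inverse (similarly $\mathcal{R}_{\bm{N}}$). Binary matrix completion: in each round $t=1,\dots,T$ the adversary sends $(i_t,j_t)\in[m]\times[n]$, the algorithm predicts $\hat y_t\in\{-1,1\}$, and the adversary reveals $y_t\in\{-1,1\}$; $\mathcal{S}=((i_1,j_1),y_1),\dots,((i_T,j_T),y_T)$ and $M$ is the number of rounds with $\hat y_t\ne y_t$. For $\bm{P}\in\mathbb{R}^{m\times d}$, $\bm{Q}\in\mathbb{R}^{n\times d}$ (any $d$, nonzero rows), $\bar{\bm{P}},\bar{\bm{Q}}$ are obtained by dividing each row by its Euclidean norm. $\mathcal{X}$ is the set of matrices $\bar{\bm{P}}\bar{\bm{Q}}^T$ over all such $\bm{P},\bm{Q}$ with $\mathcal{R}_{\bm{M}}\mathrm{Tr}(\bar{\bm{P}}^T\bm{M}\bar{\bm{P}})+\mathcal{R}_{\bm{N}}\mathrm{Tr}(\bar{\bm{Q}}^T\bm{N}\bar{\bm{Q}})\le\widehat{\mathcal{D}}$; an infimum or minimum over $\bar{\bm{P}}\bar{\bm{Q}}^T\in\mathcal{X}$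 ranges over the pairs $(\bm{P},\bm{Q})$ satisfying this constraint. Put $$\bm{W}_{\bm{P},\bm{Q}}=\begin{bmatrix}\bar{\bm{P}}\\\bar{\bm{Q}}\end{bmatrix}\begin{bmatrix}\bar{\bm{P}}^T&\bar{\bm{Q}}^T\end{bmatrix},\quad \bm{\Gamma}=\begin{bmatrix}\sqrt{\mathcal{R}_{\bm{M}}\bm{M}}&0\\0&\sqrt{\mathcal{R}_{\bm{N}}\bm{N}}\end{bmatrix},$$ $$\mathcal{K}=\{\bm{W}\in\mathbb{S}^{N\times N}_{++}:\ \forall i\in[N],\ \bm{W}_{i,i}\le1,\ \mathrm{Tr}(\bm{\Gamma}\bm{W}\bm{\Gamma})\le\widehat{\mathcal{D}}\},$$ $$\mathcal{L}=\{c\,\bm{Z}\langle i,j\rangle:\ c\in\{-1/\gamma,1/\gamma\},\ i\in[m],\ j\in[n]\},\qquad \bm{Z}\langle i,j\rangle=\tfrac12(\bm{e}_i\bm{e}_{m+j}^T+\bm{e}_{m+j}\bm{e}_i^T).$$ OSDP problem $(\mathcal{K},\mathcal{L})$: in each round $t$ the algorithm chooses $\bm{W}_t\in\mathcal{K}$, then receives $\bm{L}_t\in\mathcal{L}$ and incurs loss $\bm{W}_t\bullet\bm{L}_t$; $\mathrm{Regret}_{\mathrm{OSDP}}(T,\mathcal{K},\mathcal{L},\bm{W}^* )=\sum_{t=1}^T(\bm{W}_t-\bm{W}^* )\bullet\bm{L}_t$. Hinge loss: $h_\gamma(x)=0$ if $\gamma\le x$ and $1-x/\gamma$ otherwise;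 $\mathrm{hloss}(\mathcal{S},(\bm{P},\bm{Q}),\gamma)=\sum_{t=1}^Th_\gamma\left(\frac{y_t\bm{P}_{i_t}\bm{Q}_{j_t}^T}{\|\bm{P}_{i_t}\|_2\|\bm{Q}_{j_t}\|_2}\right)$; $\mathrm{hloss}(\mathcal{S},\gamma)=\min_{\bar{\bm{P}}\bar{\bm{Q}}^T\in\mathcal{X}}\mathrm{hloss}(\mathcal{S},(\bm{P},\bm{Q}),\gamma)$. *)

(* Defs.v *)
From HB Require Import structures.
From mathcomp Require Import all_boot all_order all_algebra.
From mathcomp Require Import all_classical all_reals ereal topology normedtype.
Set Implicit Arguments.
Unset Strict Implicit.
Unset Printing Implicit Defensive.
Import Order.TTheory GRing.Theory Num.Theory.
Local Open Scope classical_set_scope.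
Local Open Scope ring_scope.

(* MathComp-Analysis; the reals are an arbitrary R : realType. *)

Section LinearAlgebra.
Context {R : realType}.

Definition posdef k (A : 'M[R]_k) : Prop :=
  A^T = A /\ forall x : 'cV[R]_k, x != 0 -> 0 < (x^T *m A *m x) 0 0.

Definition possemidef k (A : 'M[R]_k) : Prop :=
  A^T = A /\ forall x : 'cV[R]_k, 0 <= (x^T *m A *m x) 0 0.

Definition frob k l (A B : 'M[R]_(k, l)) : R := \sum_i \sum_j A i j * B i j.

(* The default 0 is never reached for a positive semidefinite A, which has
   exactly one positive semidefinite square root. *)
Definition sqrtmx k (A : 'M[R]_k) : 'M[R]_k :=
  xget 0 [set S : 'M[R]_k | possemidef S /\ S *m S = A].

(* The Moore-Penrose inverse, given by the four Penrose conditions;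
   MathComp's pinvmx is a generalized inverse that need not satisfy them. *)
Definition is_mp_inverse k l (A : 'M[R]_(k, l)) (B : 'M[R]_(l, k)) : Prop :=
  [/\ A *m B *m A = A, B *m A *m B = B,
      (A *m B)^T = A *m B & (B *m A)^T = B *m A].

Definition mp_inverse k l (A : 'M[R]_(k, l)) : 'M[R]_(l, k) :=
  xget 0 [set B : 'M[R]_(l, k) | is_mp_inverse A B].

(* For k > 0 and A positive semidefinite the diagonal of the Moore-Penrose
   inverse is nonnegative, so that the initial value 0 does not change the
   maximum. *)
Definition sqradius k (A : 'M[R]_k) : R :=
  \big[Num.max/0]_(i < k) mp_inverse A i i.

(* The Euclidean norm; the library norm `|v| of a matrix is the sup norm. *)
Definition norm2 d (v : 'rV[R]_d) : R := Num.sqrt (\sum_k v 0 k ^+ 2).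

Definition normalize_rows k d (P : 'M[R]_(k, d)) : 'M[R]_(k, d) :=
  \matrix_(i, j) (P i j / norm2 (row i P)).

Definition hinge (gamma x : R) : R := if gamma <= x then 0 else 1 - x / gamma.

End LinearAlgebra.

Section OSDP.
Context {R : realType} {k : nat}.

(* A deterministic online algorithm: the iterate W_t as a function of the
   sequence L_1, ..., L_(t-1) of the losses received so far. *)
Definition osdp_strategy := seq 'M[R]_k -> 'M[R]_k.

Definition osdp_algorithm (K L : set 'M[R]_k) (A : osdp_strategy) : Prop :=
  forall Ls : seq 'M[R]_k, (forall X, X \in Ls -> L X) -> K (A Ls).

Definition regret (A : osdp_strategy) (Ls : seq 'M[R]_k) (W : 'M[R]_k) : R :=
  \sum_(t < size Ls) frob (A (take t Ls) - W) Ls`_t.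

End OSDP.

Section MatrixCompletion.
Context {R : realType} {m n : nat}.

(* A label is a boolean: true stands for 1 and false for -1. *)
Definition label (b : bool) : R := if b then 1 else -1.

Definition example := (('I_m * 'I_n) * bool)%type.

Definition mc_algorithm := seq example -> 'I_m * 'I_n -> bool.

Definition mistakes (B : mc_algorithm) (S : seq example) : nat :=
  \sum_(t < size S)
    (B (take t S) (tnth (in_tuple S) t).1 != (tnth (in_tuple S) t).2).

(* A matrix completion algorithm that runs an OSDP algorithm as a subroutine:
   given the past rounds and the current iterate of the subroutine, it predicts
   the label of the requested entry and, once the round is revealed, it feeds
   at most one loss matrix to the subroutine. *)
Record osdp_client := OsdpClient {
  client_predict : seq example -> 'M[R]_(m + n) -> 'I_m * 'I_n -> bool;
  client_feed :
    seq example -> 'M[R]_(m + n) -> example -> option 'M[R]_(m + n) }.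

(* The state consists of the past rounds and of the losses fed so far. *)
Definition client_step (A : osdp_strategy) (C : osdp_client)
    (s : seq example * seq 'M[R]_(m + n)) (e : example) :=
  (rcons s.1 e,
   if client_feed C s.1 (A s.2) e is Some L then rcons s.2 L else s.2).

Definition fed_losses (A : osdp_strategy) (C : osdp_client)
    (S : seq example) : seq 'M[R]_(m + n) :=
  (foldl (client_step A C) ([::], [::]) S).2.

Definition mc_of_client (A : osdp_strategy) (C : osdp_client) : mc_algorithm :=
  fun past ij => client_predict C past (A (fed_losses A C past)) ij.

(* e_(m+j), with 0-based indices, is the basis vector number rshift m j. *)
Definition Zmx (i : 'I_m) (j : 'I_n) : 'M[R]_(m + n) :=
  2^-1 *: (delta_mx (lshift n i) (rshift m j)
           + delta_mx (rshift m j) (lshift n i)).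

Definition calL (gamma : R) : set 'M[R]_(m + n) :=
  [set L | exists (c : R) (i : 'I_m) (j : 'I_n),
      (c = - (1 / gamma) \/ c = 1 / gamma) /\ L = c *: Zmx i j].

Definition Gamma (M : 'M[R]_m) (N : 'M[R]_n) : 'M[R]_(m + n) :=
  block_mx (sqrtmx (sqradius M *: M)) 0 0 (sqrtmx (sqradius N *: N)).

Definition calK (M : 'M[R]_m) (N : 'M[R]_n) (D : R) : set 'M[R]_(m + n) :=
  [set W | [/\ posdef W, forall i, W i i <= 1
             & \tr (Gamma M N *m W *m Gamma M N) <= D]].

Definition feasible (M : 'M[R]_m) (N : 'M[R]_n) (D : R) d
    (P : 'M[R]_(m, d)) (Q : 'M[R]_(n, d)) : Prop :=
  [/\ forall i, row i P != 0, forall j, row j Q != 0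
    & sqradius M * \tr ((normalize_rows P)^T *m M *m normalize_rows P)
      + sqradius N * \tr ((normalize_rows Q)^T *m N *m normalize_rows Q) <= D].

(* The infimum over calX, that is, over the feasible pairs with any inner
   dimension d; it is +oo if there is no such pair. *)
Definition inf_calX (M : 'M[R]_m) (N : 'M[R]_n) (D : R)
    (F : forall d, 'M[R]_(m, d) -> 'M[R]_(n, d) -> R) : \bar R :=
  ereal_inf [set x | exists d (P : 'M[R]_(m, d)) (Q : 'M[R]_(n, d)),
    feasible M N D P Q /\ x = (F d P Q)%:E].

Definition Wmx d (P : 'M[R]_(m, d)) (Q : 'M[R]_(n, d)) : 'M[R]_(m + n) :=
  col_mx (normalize_rows P) (normalize_rows Q)
  *m row_mx (normalize_rows P)^T (normalize_rows Q)^T.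

Definition hloss (gamma : R) (S : seq example) d
    (P : 'M[R]_(m, d)) (Q : 'M[R]_(n, d)) : R :=
  \sum_(e <- S)
    hinge gamma (label e.2 * (row e.1.1 P *m (row e.1.2 Q)^T) 0 0
                 / (norm2 (row e.1.1 P) * norm2 (row e.1.2 Q))).

(* The best hinge loss, defined in the literature as a minimum: if there is a
   feasible pair, the infimum is attained, since it may be taken over the
   compact set of the Gram matrices Wmx P Q. *)
Definition hloss_min (M : 'M[R]_m) (N : 'M[R]_n) (D gamma : R)
    (S : seq example) : \bar R :=
  inf_calX M N D (fun d P Q => hloss gamma S P Q).

End MatrixCompletion.

Arguments osdp_strategy : clear implicits.
Arguments example : clear implicits.
Arguments mc_algorithm : clear implicits.
Arguments osdp_client : clear implicits.

(* Main.v *)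
Require Import Defs.
From mathcomp Require Import all_boot all_order all_algebra.
From mathcomp Require Import all_classical all_reals ereal topology normedtype.
From mathcomp Require Import sesquilinear spectral complex.
Import Order.TTheory GRing.Theory Num.Theory.
From mathcomp Require Import ring lra.
Local Open Scope classical_set_scope.
Local Open Scope ring_scope.

(** The reduction predicts the sign of the entry of the current OSDP iterate
W_t that corresponds to the requested pair (i, j) and, only when this sign is
wrong, feeds back the loss L = -(y / gamma) Z<i,j>.  Writing W . L for the Frobenius
product, W . Z<i,j> is the (i, m + j) entry of a symmetric W, so that a mistake
forces W_t . L >= 0, whereas W_(P,Q) . L = - x / gamma where x is the margin of
(P, Q) on that round.  As the
hinge loss is at least 1 - x / gamma, each mistake costs at most
(W_t - W_(P,Q)) . L plus the hinge loss of (P, Q) on that round; the other rounds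
have nonnegative hinge loss and feed nothing.  Summation over the rounds
([sign_client_bound]) gives the first inequality, for every pair (P, Q).

For the second one, the regret against W_(P,Q) has to be compared with the
supremum over K.  The matrix W_(P,Q) has unit diagonal and satisfies the trace
constraint, but it is only positive semidefinite, so that in general it lies
outside of K.  However, K contains the first iterate V of the OSDP algorithm, and
(1 - e) W_(P,Q) + e V is in K for all 0 < e <= 1 ([calK_segment]).  The regret is
affine in its comparator, so letting e tend to 0 bounds the regret against
W_(P,Q) by the supremum ([regret_Wmx_le_sup]).

The trace constraint in K involves Gamma, which is built from the square roots
of the scaled matrices R_M M and R_N N, while that on (P, Q) involves these
matrices themselves.  The two agree because Tr(Gamma W Gamma) = Tr(Gamma^2 W), once the positive
semidefinite square root is known to exist ([possemidef_sqrt_exists]).  That is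
derived from the spectral theorem over the complex numbers. *)

(** * Square roots of positive semidefinite matrices *)

Lemma poly_interpolation (F : fieldType) (f : F -> F) (s : seq F) :
  uniq s -> exists q : {poly F}, forall x, x \in s -> q.[x] = f x.
Proof.
elim: s => [|a s IH] /= => [_|/andP[a_s /IH[q qP]]]; first by exists 0.
pose w : {poly F} := \prod_(y <- s) ('X - y%:P).
have wa : w.[a] != 0.
  by apply: contra a_s; rewrite -rootE /w root_prod_XsubC.
exists (q + ((f a - q.[a]) / w.[a])%:P * w) => x.
rewrite inE !hornerE => /predU1P[->|xs]; first by rewrite divfK// subrKC.
have /eqP-> : w.[x] == 0 by rewrite -rootE /w root_prod_XsubC.
by rewrite mulr0 addr0 qP.
Qed.

(** This is the real spectral theorem in polynomial form.  Over the complex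
numbers a symmetric real matrix is unitarily diagonalizable with real
eigenvalues, so its complex minimal polynomial is a product of distinct real
linear factors; the minimal polynomial does not change under field extension.
Stating the result on the minimal polynomial avoids any search for a real basis
of eigenvectors. *)
Lemma mxminpoly_symmetric (R : rcfType) k (A : 'M[R]_k.+1) : A^T = A ->
  exists2 rs, uniq rs & mxminpoly A = \prod_(r <- rs) ('X - r%:P).
Proof.
move=> symA; set toC := real_complex R.
pose B := map_mx toC A.
have hermB : B \is hermsymmx.
  apply: realsym_hermsym; last first.
    by apply/mxOverP => i j; rewrite mxE; apply/complex_realP; exists (A i j).
  by apply/is_hermitianmxP; rewrite expr0 scale1r map_mx_id// /B map_trmx symA.
have /orthomx_spectralP BE := hermitian_normalmx hermB.
have dreal := hermitian_spectral_diag_real hermB.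
set P := spectralmx B in BE; set d := spectral_diag B in BE dreal.
pose rs := undup [seq complex.Re (d 0 i) | i <- enum 'I_k.+1].
exists rs; first exact: undup_uniq.
apply: (map_poly_inj toC).
rewrite -mxminpoly_map -/B BE -[_ *m P]conjVmx ?spectral_unit//.
rewrite mxminpoly_uconj ?unitmx_inv ?spectral_unit// mxminpoly_diag.
rewrite rmorph_prod /=.
under [RHS]eq_bigr => r _ do rewrite rmorphB /= map_polyX map_polyC.
rewrite -(big_map toC xpredT (fun r => 'X - r%:P)) -undup_map_inj; last first.
  exact: fmorph_inj.
rewrite -[map toC _]map_comp; congr (\prod_(r <- undup _) _).
apply: eq_map => i /=; apply/esym/RRe_real.
by move/mxOverP : dreal; apply.
Qed.

Lemma mulmx_tr_sumsq (R : comNzRingType) k (v : 'rV[R]_k) :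
  (v *m v^T) 0 0 = \sum_j v 0 j ^+ 2.
Proof. by rewrite mxE; apply: eq_bigr => j _; rewrite mxE expr2. Qed.

Lemma sumsq_gt0 (R : realDomainType) k (v : 'rV[R]_k) :
  v != 0 -> 0 < \sum_j v 0 j ^+ 2.
Proof.
move=> v0; rewrite lt_neqAle sumr_ge0 ?andbT => [|j _]; last exact: sqr_ge0.
apply: contra v0; rewrite eq_sym psumr_eq0 => [|j _]; last exact: sqr_ge0.
move=> /allP v0; apply/eqP/rowP => j; rewrite mxE; apply/eqP.
by have := v0 j (mem_index_enum _); rewrite sqrf_eq0.
Qed.

Lemma possemidef_eigenvalue_ge0 (R : realType) k (A : 'M[R]_k) a :
  possemidef A -> eigenvalue A a -> 0 <= a.
Proof.
move=> [_ posA] /eigenvalueP[v vA v0].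
have := posA v^T; rewrite trmxK vA -scalemxAl mxE mulmx_tr_sumsq.
by rewrite pmulr_lge0// sumsq_gt0.
Qed.

Lemma trmx_horner_mx (R : comNzRingType) k (A : 'M[R]_k.+1) (q : {poly R}) :
  (horner_mx A q)^T = horner_mx A^T q.
Proof.
elim/poly_ind: q => [|q c IH]; first by rewrite !rmorph0 trmx0.
rewrite !rmorphD !rmorphM /= !horner_mx_X !horner_mx_C linearD /=.
rewrite tr_scalar_mx trmx_mul IH; congr (_ + _).
exact/comm_mx_horner/comm_mx_refl.
Qed.

Lemma possemidef_gram (R : realType) k l (B : 'M[R]_(k, l)) :
  possemidef (B *m B^T).
Proof.
split=> [|x]; first by rewrite trmx_mul trmxK.
rewrite mulmxA -mulmxA -[B^T *m x]trmxK trmx_mul trmxK mulmx_tr_sumsq.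
by apply: sumr_ge0 => j _; exact: sqr_ge0.
Qed.

(** Interpolating x^(1/4) at the eigenvalues gives a real polynomial q with
q(A)^4 = A.  The fourth root is used instead of the square root because
q(A)^2 = q(A) q(A)^T is then visibly positive semidefinite. *)
Lemma possemidef_sqrt_exists (R : realType) k (A : 'M[R]_k) :
  possemidef A -> exists2 S, possemidef S & S *m S = A.
Proof.
case: k A => [|k] A psdA.
  by exists A => //; apply/matrixP => -[].
have [rs urs minA] := mxminpoly_symmetric _ _ _ psdA.1.
have [q qP] := poly_interpolation _ (fun x => Num.sqrt (Num.sqrt x)) _ urs.
have qE : horner_mx A (q ^+ 4) = A.
  rewrite -[RHS]horner_mx_X; apply/eqP; rewrite -subr_eq0 -rmorphB.
  apply/eqP/mxminpoly_minP; rewrite minA.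
  apply: uniq_roots_dvdp; last by rewrite uniq_rootsE.
  apply/allP => r rrs.
  have r0 : 0 <= r.
    apply: (possemidef_eigenvalue_ge0 _ _ _ _ psdA).
    by rewrite eigenvalue_root_min minA root_prod_XsubC.
  by rewrite rootE !hornerE qP// (exprM _ 2 2) !sqr_sqrtr ?sqrtr_ge0 ?subrr.
pose B := horner_mx A q.
have symB : B^T = B by rewrite trmx_horner_mx psdA.1.
exists (B *m B); first by rewrite -{2}symB; exact: possemidef_gram.
by rewrite -[RHS]qE rmorphXn /= -/B !exprS expr0 mulr1 !mulmxE !mulrA.
Qed.

Lemma sqrtmxK (R : realType) k (A : 'M[R]_k) :
  possemidef A -> sqrtmx A *m sqrtmx A = A.
Proof.
move=> /possemidef_sqrt_exists[S psdS SS].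
by have [] := xgetPex 0 (ex_intro [set S | possemidef S /\ S *m S = A] S (conj psdS SS)).
Qed.

(** * The Frobenius product and the regret *)

Lemma frobDl (R : realType) k l (U V L : 'M[R]_(k, l)) :
  frob (U + V) L = frob U L + frob V L.
Proof.
rewrite /frob -big_split; apply: eq_bigr => i _ /=.
by rewrite -big_split; apply: eq_bigr => j _; rewrite mxE mulrDl.
Qed.

Lemma frobZl (R : realType) k l c (U L : 'M[R]_(k, l)) :
  frob (c *: U) L = c * frob U L.
Proof.
rewrite /frob big_distrr; apply: eq_bigr => i _ /=.
by rewrite big_distrr; apply: eq_bigr => j _ /=; rewrite mxE mulrA.
Qed.

Lemma frobBl (R : realType) k l (U V L : 'M[R]_(k, l)) :
  frob (U - V) L = frob U L - frob V L.
Proof. by rewrite frobDl -scaleN1r frobZl mulN1r. Qed.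

Lemma frobC (R : realType) k l (U V : 'M[R]_(k, l)) : frob U V = frob V U.
Proof. by rewrite /frob; do 2!apply: eq_bigr => ? _; rewrite mulrC. Qed.

Lemma frob_delta (R : realType) k l (U : 'M[R]_(k, l)) i j :
  frob U (delta_mx i j) = U i j.
Proof.
rewrite /frob (bigD1 i)//= [X in _ + X]big1 => [|i' /negPf i'i]; last first.
  by apply: big1 => j' _; rewrite mxE i'i mulr0.
rewrite (bigD1 j)//= big1 => [|j' /negPf j'j]; last by rewrite mxE j'j andbF mulr0.
by rewrite mxE !eqxx mulr1 !addr0.
Qed.

Lemma frob_Zmx (R : realType) m n (W : 'M[R]_(m + n)) i j :
  frob W (Zmx i j) =
  2^-1 * (W (lshift n i) (rshift m j) + W (rshift m j) (lshift n i)).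
Proof. by rewrite frobC frobZl frobDl !(frobC _ _ _ _ W) !frob_delta. Qed.

Lemma regret_rcons (R : realType) k (A : osdp_strategy R k) Ls L W :
  regret A (rcons Ls L) W = regret A Ls W + frob (A Ls - W) L.
Proof.
rewrite /regret size_rcons big_ord_recr /=; congr (_ + _).
  apply: eq_bigr => t _; rewrite nth_rcons ltn_ord -cats1 takel_cat//.
  exact: ltnW.
by rewrite nth_rcons ltnn eqxx -cats1 take_size_cat.
Qed.

Lemma regret_convex (R : realType) k (A : osdp_strategy R k) Ls W V e :
  regret A Ls ((1 - e) *: W + e *: V) =
  (1 - e) * regret A Ls W + e * regret A Ls V.
Proof.
rewrite /regret !big_distrr /= -big_split; apply: eq_bigr => t _ /=.
rewrite !frobBl frobDl !frobZl; ring.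
Qed.

(** * The matrix completion algorithm *)

Lemma mistakes_rcons m n (B : mc_algorithm m n) S e :
  mistakes B (rcons S e) = (mistakes B S + (B S e.1 != e.2))%N.
Proof.
rewrite /mistakes; under eq_bigr do rewrite (tnth_nth e) /=.
under [in RHS]eq_bigr do rewrite (tnth_nth e) /=.
rewrite size_rcons big_ord_recr /=; congr (_ + _)%N.
  apply: eq_bigr => t _; rewrite nth_rcons ltn_ord -cats1 takel_cat//.
  exact: ltnW.
by rewrite nth_rcons ltnn eqxx -cats1 take_size_cat.
Qed.

Lemma hloss_rcons (R : realType) m n (gamma : R) S e d
    (P : 'M[R]_(m, d)) (Q : 'M[R]_(n, d)) :
  hloss gamma (rcons S e) P Q = hloss gamma S P Q + hloss gamma [:: e] P Q.
Proof. by rewrite /hloss -cats1 big_cat. Qed.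

Lemma fed_losses_rcons (R : realType) m n (A : osdp_strategy R (m + n))
    (C : osdp_client R m n) S e :
  fed_losses A C (rcons S e) =
  let Ls := fed_losses A C S in
  if client_feed C S (A Ls) e is Some L then rcons Ls L else Ls.
Proof.
(* The first component of the state records the rounds seen so far. *)
have pastE T : (foldl (client_step A C) ([::], [::]) T).1 = T.
  by elim/last_ind: T => // T f IH; rewrite foldl_rcons /= IH.
by rewrite /fed_losses foldl_rcons /= pastE.
Qed.

(** The prediction is the sign of W . Z<i,j>, the mean of the entries of W at
(i, m + j) and (m + j, i).  The loss that W suffers on the fed matrix is a
multiple of this same number, so that a wrong prediction determines the sign of
that loss. *)
Definition sign_client (R : realType) m n (gamma : R) : osdp_client R m n :=
  let predict W ij := 0 <= frob W (Zmx ij.1 ij.2) in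
  OsdpClient (fun _ => predict)
    (fun _ W e => if predict W e.1 == e.2 then None
                  else Some (- (label e.2 / gamma) *: Zmx e.1.1 e.1.2)).

Lemma hinge_ge0 (R : realType) (gamma x : R) :
  0 < gamma -> 0 <= hinge gamma x.
Proof.
move=> g0; rewrite /hinge; case: ifPn => //; rewrite -ltNge => xg.
by rewrite subr_ge0 ler_pdivrMr// mul1r ltW.
Qed.

Lemma hinge_ge (R : realType) (gamma x : R) :
  0 < gamma -> 1 - x / gamma <= hinge gamma x.
Proof.
move=> g0; rewrite /hinge; case: ifPn => // gx.
by rewrite subr_le0 ler_pdivlMr// mul1r.
Qed.

Lemma hloss_ge0 (R : realType) m n (gamma : R) S d
    (P : 'M[R]_(m, d)) (Q : 'M[R]_(n, d)) :
  0 < gamma -> 0 <= hloss gamma S P Q.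
Proof. by move=> g0; apply: sumr_ge0 => e _; exact: hinge_ge0. Qed.

(** Here x stands for W_t . Z<i,j>: on a mistake the fed loss of the iterate is
nonnegative. *)
Lemma sign_loss_ge0 (R : realType) (gamma x : R) b :
  0 < gamma -> (0 <= x) != b -> 0 <= - (label b / gamma) * x.
Proof.
move=> g0; rewrite /label; case: b; case: leP => // x0 _.
  by rewrite mulNr -mulrN mulr_ge0 ?oppr_ge0 ?ltW// divr_gt0.
by rewrite !mulNr opprK mul1r mulr_ge0// invr_ge0 ltW.
Qed.

Lemma Wmx_gram (R : realType) m n d (P : 'M[R]_(m, d)) (Q : 'M[R]_(n, d)) :
  let B := col_mx (normalize_rows P) (normalize_rows Q) in
  Wmx P Q = B *m B^T.
Proof. by rewrite /= tr_col_mx. Qed.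

Lemma Wmx_offdiag (R : realType) m n d (P : 'M[R]_(m, d)) (Q : 'M[R]_(n, d))
    i j :
  Wmx P Q (lshift n i) (rshift m j) =
  (row i P *m (row j Q)^T) 0 0 / (norm2 (row i P) * norm2 (row j Q)).
Proof.
rewrite /Wmx !mxE big_distrl; apply: eq_bigr => k _ /=.
rewrite col_mxEu row_mxEr !mxE invfM; ring.
Qed.

Lemma frob_Wmx_Zmx (R : realType) m n d (P : 'M[R]_(m, d)) (Q : 'M[R]_(n, d))
    i j :
  frob (Wmx P Q) (Zmx i j) =
  (row i P *m (row j Q)^T) 0 0 / (norm2 (row i P) * norm2 (row j Q)).
Proof.
have symW : (Wmx P Q)^T = Wmx P Q by rewrite Wmx_gram trmx_mul trmxK.
have symWij :
    Wmx P Q (rshift m j) (lshift n i) = Wmx P Q (lshift n i) (rshift m j).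
  by rewrite -{1}symW mxE.
rewrite frob_Zmx symWij -Wmx_offdiag; lra.
Qed.

(** A correct round adds a nonnegative hinge loss to the right-hand side; on a
mistake, [sign_loss_ge0] and [hinge_ge] show that the regret and the hinge loss
together grow by at least 1. *)
Lemma sign_client_bound (R : realType) m n (gamma : R)
    (A : osdp_strategy R (m + n)) S (C := sign_client R m n gamma) :
  0 < gamma ->
  [/\ size (fed_losses A C S) = mistakes (mc_of_client A C) S,
      forall L, L \in fed_losses A C S -> calL gamma L
    & forall d (P : 'M[R]_(m, d)) (Q : 'M[R]_(n, d)),
      (mistakes (mc_of_client A C) S)%:R <=
      regret A (fed_losses A C S) (Wmx P Q) + hloss gamma S P Q].
Proof.
move=> g0; elim/last_ind: S => [|S e [sizeLs LsL bound]].
  split=> // [|d P Q]; first by rewrite /mistakes big_ord0.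
  by rewrite /mistakes /regret !big_ord0 /hloss big_nil addr0.
rewrite mistakes_rcons fed_losses_rcons /=.
set Ls := fed_losses A C S in sizeLs LsL bound *.
set g := frob _ _; case: ifPn => /= mist.
  rewrite addn0; split=> // d P Q.
  by rewrite hloss_rcons addrA ler_wpDr ?hloss_ge0.
split; first by rewrite size_rcons sizeLs addn1.
  move=> L; rewrite mem_rcons inE => /predU1P[->|/LsL//].
  exists (- (label e.2 / gamma)), e.1.1, e.1.2; split=> //.
  by rewrite /label; case: e.2; [left | right; rewrite mulN1r opprK div1r].
move=> d P Q; rewrite natrD regret_rcons hloss_rcons addrACA lerD//.
rewrite frobC frobZl frobC frobBl frob_Wmx_Zmx -/g /hloss big_seq1 -mulrA.
set x := _ 0 0 / _.
have := hinge_ge _ _ (label e.2 * x) g0.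
have := sign_loss_ge0 _ _ _ _ g0 mist; lra.
Qed.

(** * Comparators on the boundary of the decision set *)

Lemma Wmx_diag (R : realType) m n d (P : 'M[R]_(m, d)) (Q : 'M[R]_(n, d)) :
  (forall i, row i P != 0) -> (forall j, row j Q != 0) ->
  forall i, Wmx P Q i i = 1.
Proof.
have unit_row k (X : 'M[R]_(k, d)) i : row i X != 0 ->
    \sum_j normalize_rows X i j ^+ 2 = 1.
  move=> /sumsq_gt0; set s := \sum_j _ => s0.
  rewrite -[RHS](divff (lt0r_neq0 s0)) {1}/s big_distrl.
  apply: eq_bigr => j _ /=.
  by rewrite !mxE exprMn exprVn sqr_sqrtr// ltW.
move=> P0 Q0 i; rewrite Wmx_gram mxE.
under eq_bigr => k _ do rewrite [_^T k i]mxE -expr2.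
case: (split_ordP i) => j ->.
  by under eq_bigr do rewrite col_mxEu; exact: unit_row.
by under eq_bigr do rewrite col_mxEd; exact: unit_row.
Qed.

Lemma possemidefZ (R : realType) k (A : 'M[R]_k) c :
  0 <= c -> possemidef A -> possemidef (c *: A).
Proof.
move=> c0 [symA posA]; split=> [|x]; first by rewrite linearZ /= symA.
by rewrite -scalemxAr -scalemxAl mxE mulr_ge0.
Qed.

Lemma posdef_possemidef (R : realType) k (A : 'M[R]_k) :
  posdef A -> possemidef A.
Proof.
move=> [symA posA]; split=> // x.
have [->|/posA/ltW//] := eqVneq x 0.
by rewrite mulmx0 mxE.
Qed.

Lemma sqradius_ge0 (R : realType) k (A : 'M[R]_k) : 0 <= sqradius A.
Proof.
apply: (big_rec (fun x => 0 <= x)) => // i x _ x0.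
by rewrite le_max x0 orbT.
Qed.

Lemma Gamma_sq (R : realType) m n (M : 'M[R]_m) (N : 'M[R]_n) :
  posdef M -> posdef N ->
  Gamma M N *m Gamma M N = block_mx (sqradius M *: M) 0 0 (sqradius N *: N).
Proof.
move=> /posdef_possemidef psM /posdef_possemidef psN.
rewrite /Gamma mulmx_block !(mul0mx, mulmx0, addr0, add0r).
by rewrite !sqrtmxK//; apply: possemidefZ; rewrite ?sqradius_ge0.
Qed.

Lemma trace_Gamma_Wmx (R : realType) m n (M : 'M[R]_m) (N : 'M[R]_n) d
    (P : 'M[R]_(m, d)) (Q : 'M[R]_(n, d)) :
  posdef M -> posdef N ->
  \tr (Gamma M N *m Wmx P Q *m Gamma M N) =
  sqradius M * \tr ((normalize_rows P)^T *m M *m normalize_rows P)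
  + sqradius N * \tr ((normalize_rows Q)^T *m N *m normalize_rows Q).
Proof.
move=> posM posN; rewrite mxtrace_mulC mulmxA Gamma_sq// /Wmx mulmxA.
rewrite mxtrace_mulC mulmxA mul_row_block !mulmx0 addr0 add0r mul_row_col.
by rewrite -!scalemxAr -!scalemxAl mxtraceD !mxtraceZ.
Qed.

(** The decision set is convex, and positive definiteness is the only one of its
constraints that is not closed; one positive definite endpoint suffices to
preserve it on the segment. *)
Lemma calK_segment (R : realType) m n (M : 'M[R]_m) (N : 'M[R]_n) (D : R)
    (W V : 'M[R]_(m + n)) e :
  possemidef W -> (forall i, W i i <= 1) ->
  \tr (Gamma M N *m W *m Gamma M N) <= D -> calK M N D V ->
  0 < e <= 1 -> calK M N D ((1 - e) *: W + e *: V).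
Proof.
move=> [symW posW] diagW trW [[symV posV] diagV trV] /andP[e0 e1].
have e1' : 0 <= 1 - e by rewrite subr_ge0.
split=> [|i|].
- split=> [|x x0]; first by rewrite linearD !linearZ /= symW symV.
  rewrite mulmxDr mulmxDl -!scalemxAr -!scalemxAl mxE [X in X + _]mxE.
  rewrite [X in _ + X]mxE ltr_wpDl ?mulr_ge0 ?mulr_gt0//; exact: posV.
- rewrite !mxE.
  apply: (@le_trans _ _ ((1 - e) * 1 + e * 1)); last by rewrite !mulr1 subrK.
  by apply: lerD; apply: ler_wpM2l => //; exact: ltW.
- rewrite mulmxDr mulmxDl -!scalemxAr -!scalemxAl mxtraceD !mxtraceZ.
  have -> : D = (1 - e) * D + e * D by ring.
  by apply: lerD; apply: ler_wpM2l => //; exact: ltW.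
Qed.

(** This replaces the limit e -> 0 along a segment by a choice of one explicit
point, because the function is affine in e. *)
Lemma le_of_segment (R : realFieldType) (r v s : R) :
  (forall e, 0 < e <= 1 -> (1 - e) * r + e * v <= s) -> r <= s.
Proof.
move=> seg; rewrite leNgt; apply/negP => sr.
have vs : v <= s by have := seg 1; rewrite ltr01 lexx => /(_ isT); lra.
have rv : 0 < r - v by lra.
(* If s < r, the function reaches the midpoint of s and r at this e. *)
pose e := (r - s) / (2 * (r - v)).
have e01 : 0 < e <= 1.
  rewrite /e; apply/andP; split; first by rewrite divr_gt0 ?mulr_gt0// subr_gt0.
  by rewrite ler_pdivrMr ?mulr_gt0//; lra.
have := seg e e01.
have -> : (1 - e) * r + e * v = (r + s) / 2 by rewrite /e; field; rewrite gt_eqF.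
lra.
Qed.

(** A positive definite point V of K provides the segment in K along which the
semidefinite matrix W_(P,Q) is approached. *)
Lemma regret_Wmx_le_sup (R : realType) m n (M : 'M[R]_m) (N : 'M[R]_n) (D : R)
    (A : osdp_strategy R (m + n)) Ls V d
    (P : 'M[R]_(m, d)) (Q : 'M[R]_(n, d)) :
  posdef M -> posdef N -> calK M N D V -> feasible M N D P Q ->
  ((regret A Ls (Wmx P Q))%:E
   <= ereal_sup [set (regret A Ls W)%:E | W in calK M N D])%E.
Proof.
move=> posM posN KV [P0 Q0 PQD].
have KW e : 0 < e <= 1 -> calK M N D ((1 - e) *: Wmx P Q + e *: V).
  apply: calK_segment => //; last by rewrite trace_Gamma_Wmx.
    by rewrite Wmx_gram; exact: possemidef_gram.
  by move=> i; rewrite Wmx_diag.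
set s := ereal_sup _.
have ubs W : calK M N D W -> ((regret A Ls W)%:E <= s)%E.
  by move=> ?; apply: ereal_sup_ubound; exists W.
case: s ubs => [s| |] ubs; rewrite ?leey//; last first.
  by have := ubs _ KV; rewrite leeNy_eq.
rewrite lee_fin; apply: (le_of_segment _ _ (regret A Ls V)) => e e01.
by rewrite -regret_convex -lee_fin; exact/ubs/KW.
Qed.

Theorem corollary1 (R : realType) (m n : nat) (gamma : R)
  (M : 'M[R]_m) (N : 'M[R]_n) (D : R) (A : osdp_strategy R (m + n)) :
  (0 < m)%N -> (0 < n)%N -> 0 < gamma -> posdef M -> posdef N ->
  osdp_algorithm (calK M N D) (calL gamma) A ->
  exists C : osdp_client R m n, forall S : seq (example m n),
    let nmist := mistakes (mc_of_client A C) S in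
    let Ls := fed_losses A C S in
    let bound d (P : 'M[R]_(m, d)) (Q : 'M[R]_(n, d)) :=
      regret A Ls (Wmx P Q) + hloss gamma S P Q in
    [/\ size Ls = nmist,
        forall L, L \in Ls -> calL gamma L,
        ((nmist%:R : R)%:E <= inf_calX M N D bound)%E
      & (inf_calX M N D bound <=
         ereal_sup [set (regret A Ls W)%:E | W in calK M N D]
           + hloss_min M N D gamma S)%E].
Proof.
move=> _ _ g0 posM posN algA; exists (sign_client R m n gamma) => S nmist Ls bound.
have [sizeLs LsL le_bound] := sign_client_bound _ _ _ _ A S g0.
split=> //.
  by apply: le_ereal_inf_tmp => _ [d [P [Q [_ ->]]]]; rewrite lee_fin; exact: le_bound.
have KV : calK M N D (A [::]) by exact: algA.
have supP d P Q := @regret_Wmx_le_sup R m n M N D A Ls _ d P Q posM posN KV.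
have supV : ((regret A Ls (A [::]))%:E
    <= ereal_sup [set (regret A Ls W)%:E | W in calK M N D])%E.
  by apply: ereal_sup_ubound; exists (A [::]).
have hmin0 : (0 <= hloss_min M N D gamma S)%E.
  apply: le_ereal_inf_tmp => _ [d [P [Q [_ ->]]]]; rewrite lee_fin.
  exact: hloss_ge0.
(* Neither summand is -oo: K contains the first iterate, and the hinge loss is
   nonnegative; hence the sum is +oo when the supremum is. *)
move: supP supV; set s := ereal_sup _.
case: s => [s| |] supP supV; last 2 first.
- by rewrite addye ?leey// gt_eqF// (lt_le_trans _ hmin0)// ltNy0.
- by move: supV; rewrite leeNy_eq.
rewrite -leeBlDl//; apply: le_ereal_inf_tmp => _ [d [P [Q [feasPQ ->]]]].
rewrite leeBlDl// -EFinD.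
apply: (@le_trans _ _ (bound d P Q)%:E).
  by apply: ereal_inf_lbound; exists d, P, Q.
by rewrite lee_fin lerD2r -lee_fin; exact: supP.
Qed.
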